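(* The number $N$ of all distinct fuzzy subgroups with respect to $\approx$ of the symmetric group $S_3$ (that is, the number of equivalence classes of $FL(S_3)$ modulo $\approx$) is $$N=\frac16\,(10+3\cdot 6+2\cdot 4)=6.$$
   Context: Let $G$ be a finite group. A fuzzy subgroup of $G$ is a function $\mu:G\to[0,1]$ with $\mu(xy)\ge\min\{\mu(x),\mu(y)\}$ and $\mu(x^{-1})\ge\mu(x)$ for all $x,y\in G$; $FL(G)$ denotes the set of all fuzzy subgroups of $G$. For $\alpha\in[0,1]$ put ${}_\mu G_\alpha=\{x\in G\mid \mu(x)\ge\alpha\}$. If $\mu(G)=\{\alpha_1,\dots,\alpha_r\}$ with $\alpha_1>\alpha_2>\dots>\alpha_r$, then $\mu$ determines the chain of subgroups $\mathcal{C}_\mu:\ {}_\mu G_{\alpha_1}\subset{}_\mu G_{\alpha_2}\subset\dots\subset{}_\mu G_{\alpha_r}=G$ (strict inclusions). The relation $\approx$ on $FL(G)$: $\mu\approx\eta$ iff there exists $f\in\mathrm{Aut}(G)$ with $f(\mathcal{C}_\eta)=\mathcal{C}_\mu$, i.e. the two chains have the same number of terms and $f$ maps the $i$-th term of $\mathcal{C}_\eta$ onto the $i$-th term of $\mathcal{C}_\mu$ for every $i$. The number of distinct fuzzy subgroups of $G$ with respect to $\approx$ is the number of $\approx$-classes of $FL(G)$; equivalently, it is the number of orbits of $\mathrm{Aut}(G)$ acting termwise on the set of strictly increasing chains $H_1\subset H_2\subset\dots\subset H_m=G$ ($m\ge1$) of subgroups of $G$ ending in $G$ (the first term $H_1$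 need not be trivial). *)

(* Defs.v *)
From HB Require Import structures.
From mathcomp Require Import all_boot all_order all_algebra all_fingroup.
From mathcomp Require Import all_classical all_reals.
Set Implicit Arguments.
Unset Strict Implicit.
Unset Printing Implicit Defensive.
Import Order.TTheory GRing.Theory Num.Theory.
Local Open Scope classical_set_scope.
Local Open Scope ring_scope.

(* The finite group G is the whole type [gT]; as a [{group gT}] it is
   [[set: gT]%G], and Aut(G) is [Aut [set: gT]]. *)
Definition fuzzy_subgroup (R : realType) (gT : finGroupType)
    (mu : gT -> R) : Prop :=
  [/\ forall x, 0 <= mu x <= 1,
      forall x y, Num.min (mu x) (mu y) <= mu (x * y)%g
    & forall x, mu x <= mu x^-1%g].

Definition FL (R : realType) (gT : finGroupType) : set (gT -> R) :=
  [set mu | fuzzy_subgroup mu].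

Definition level_set (R : realType) (gT : finGroupType) (mu : gT -> R)
    (alpha : R) : {set gT} :=
  finset (fun x => alpha <= mu x).

(* mu(G) listed strictly decreasingly, so that the level sets in
   [fuzzy_chain] are strictly increasing and end in G. *)
Definition fuzzy_values (R : realType) (gT : finGroupType) (mu : gT -> R) :
    seq R :=
  sort >=%R (undup (codom mu)).

Definition fuzzy_chain (R : realType) (gT : finGroupType) (mu : gT -> R) :
    seq {set gT} :=
  [seq level_set mu alpha | alpha <- fuzzy_values mu].

Definition fuzzy_approx (R : realType) (gT : finGroupType)
    (mu eta : gT -> R) : Prop :=
  exists2 f : {perm gT}, f \in Aut [set: gT]%G
    & [seq (f @: H)%SET | H : {set gT} <- fuzzy_chain eta]
      = fuzzy_chain mu.

Definition fuzzy_classes (R : realType) (gT : finGroupType) :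
    set (set (gT -> R)) :=
  [set [set eta | FL eta /\ fuzzy_approx mu eta] | mu in @FL R gT].

Arguments FL R gT : clear implicits.
Arguments fuzzy_classes R gT : clear implicits.

(* Main.v *)
(** The automorphism orbit of a chain of subgroups of [S_3] ending in [S_3] is
    determined by the sequence of orders of its terms: subgroups of order 1, 3
    or 6 are unique, and those of order 2, being Sylow, are conjugate. A strict
    chain whose orders divide 6 has at most one term of order 2 or 3, so the
    possible sequences of orders are the subsets of {1, 2, 3, 6} which contain 6
    and not both 2 and 3; each is realized by a fuzzy subgroup that takes
    the value [1 / (i + 1)] on the [i]-th layer of the chain. *)
Require Import Defs.
From mathcomp Require Import all_boot all_order all_algebra all_fingroup.
From mathcomp Require Import all_solvable.
From mathcomp Require Import all_classical all_reals.
Set Implicit Arguments.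
Unset Strict Implicit.
Unset Printing Implicit Defensive.
Import Order.TTheory GRing.Theory Num.Theory.
Local Open Scope classical_set_scope.
Local Open Scope card_scope.
Local Open Scope ring_scope.

(** * Chains of subgroups and the chain of a fuzzy subgroup *)

Definition chain_orders (gT : finGroupType) (s : seq {set gT}) : seq nat :=
  [seq #|H| | H : {set gT} <- s].

(** Membership of the whole group makes it the last term, as no set contains it properly. *)
Definition subgroup_chain (gT : finGroupType) (s : seq {set gT}) : bool :=
  [&& all (@group_set gT) s, sorted (fun A B : {set gT} => A \proper B) s
    & ([set: gT]%SET : {set gT}) \in s].

Section FuzzyChain.
Variables (R : realType) (gT : finGroupType).
Local Notation G := ([set: gT]%SET : {set gT}).
Implicit Types (mu eta : gT -> R) (s : seq {set gT}).

Lemma fuzzy_values_sorted mu : sorted >%R (fuzzy_values mu).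
Proof.
have -> : sorted >%R (fuzzy_values mu) = sorted <%R (rev (fuzzy_values mu)).
  by rewrite rev_sorted.
rewrite lt_sorted_uniq_le rev_uniq sort_uniq undup_uniq rev_sorted.
by apply: sort_sorted => x y; apply: le_total.
Qed.

Lemma mem_fuzzy_values mu : fuzzy_values mu =i codom mu.
Proof. by move=> a; rewrite mem_sort mem_undup. Qed.

Lemma fuzzy_values_unique mu (v : seq R) :
  sorted >%R v -> v =i codom mu -> fuzzy_values mu = v.
Proof.
move=> sv ev; apply: (irr_sorted_eq (leT := >%R)) => //.
- by move=> x y z /= h1 h2; apply: lt_trans h2 h1.
- by move=> x /=; rewrite ltxx.
- exact: fuzzy_values_sorted.
- by move=> a; rewrite mem_fuzzy_values ev.
Qed.

(** Taking the level at a value [mu x] puts [1 = x * x^-1] in the level set; in a finite group,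
    closure under products then suffices. *)
Lemma level_set_group mu x : fuzzy_subgroup mu ->
  group_set (level_set mu (mu x)).
Proof.
case=> _ muM muV; apply/group_setP; split=> [|y z].
  rewrite inE -(mulgV x); apply: le_trans (muM _ _).
  by rewrite le_min lexx muV.
rewrite !inE => hy hz; apply: le_trans (muM _ _).
by rewrite le_min hy hz.
Qed.

Lemma fuzzy_chain_subgroup_chain mu :
  fuzzy_subgroup mu -> subgroup_chain (fuzzy_chain mu).
Proof.
move=> Fmu; apply/and3P; split.
- apply/allP => H /mapP[a]; rewrite mem_fuzzy_values => /codomP[x ->] ->.
  exact: level_set_group.
- rewrite sorted_map.
  apply: (sub_in_sorted (P := mem (codom mu))) (fuzzy_values_sorted mu).
    move=> a b _ /codomP[y ->] /= ba; apply/properP; split.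
      by apply/fintype.subsetP => x; rewrite !inE; apply: le_trans (ltW ba).
    (* A point where the smaller value is attained lies only in the larger level set. *)
    by exists y; rewrite inE ?lexx // -ltNge.
  by apply/allP => a; rewrite mem_fuzzy_values.
- have [x _ xmin] := @arg_minP _ _ _ 1%g xpredT mu isT.
  apply/mapP; exists (mu x); first by rewrite mem_fuzzy_values codom_f.
  by apply/setP => y; rewrite !inE xmin.
Qed.

(** * Realizing a chain by a fuzzy subgroup *)

Section Realize.
Variable s : seq {set gT}.
Hypothesis sC : subgroup_chain s.
Local Notation layer x := (find (fun H : {set gT} => x \in H) s).

(** Layers are counted from 0, so the first term of the chain gets the value 1. *)
Definition chain_fuzzy (x : gT) : R := (layer x).+1%:R^-1.

Lemma chain_nth_subset i j : (i <= j < size s)%N -> nth G s i \subset nth G s j.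
Proof.
move=> /andP[ij js]; case/and3P: sC => _ ss _.
have sub_trans : transitive (fun A B : {set gT} => A \subset B).
  by move=> B A C; apply: fintype.subset_trans.
have sorted_sub : sorted (fun A B : {set gT} => A \subset B) s.
  by apply: sub_sorted ss => A B; apply: proper_sub.
apply: (sorted_leq_nth sub_trans _ _ sorted_sub) => //.
exact: leq_ltn_trans js.
Qed.

Lemma chain_find_lt x : (layer x < size s)%N.
Proof.
case/and3P: sC => _ _ sT.
by rewrite -has_find; apply/hasP; exists G; rewrite ?inE.
Qed.

(** The terms increase, so an element stays in every term after the first one that contains it. *)
Lemma chain_find_le x i : (i < size s)%N ->
  (layer x <= i)%N = (x \in nth G s i).
Proof.
move=> is_; apply/idP/idP => [fi|].
  apply: (fintype.subsetP (chain_nth_subset (introT andP (conj fi is_)))).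
  by apply: (@nth_find _ _ (fun H : {set gT} => x \in H));
    rewrite has_find chain_find_lt.
by apply: contraTT; rewrite -ltnNge => /(before_find G) ->.
Qed.

Lemma chain_fuzzy_le x i :
  (i.+1%:R^-1 <= chain_fuzzy x) = (layer x <= i)%N.
Proof. by rewrite lef_pV2 ?posrE ?ltr0n // ler_nat. Qed.

Lemma chain_group i : (i < size s)%N -> group_set (nth G s i).
Proof.
by move=> is_; case/and3P: sC => /allP sg _ _; apply/sg/mem_nth.
Qed.

Lemma chain_fuzzy_subgroup : fuzzy_subgroup chain_fuzzy.
Proof.
split=> [x|x y|x].
- by rewrite invr_ge0 ler0n invf_le1 ?ltr0n // ler1n.
(* Take [m] to be the larger layer: both factors lie in the [m]-th term, a subgroup, and the larger
   layer has the smaller value. *)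
- have aux m (mx : (layer x <= m)%N) (my : (layer y <= m)%N) :
    (m < size s)%N -> m.+1%:R^-1 <= chain_fuzzy (x * y)%g.
    move=> ms; rewrite chain_fuzzy_le chain_find_le //.
    have /group_setP[_ gM] := chain_group ms.
    by apply: gM; rewrite -chain_find_le.
  have [le_xy|lt_yx] := leqP (layer x) (layer y).
    apply: le_trans (aux _ le_xy (leqnn _) (chain_find_lt y)).
    by rewrite ge_min lexx orbT.
  apply: le_trans (aux _ (leqnn _) (ltnW lt_yx) (chain_find_lt x)).
  by rewrite ge_min lexx.
- rewrite chain_fuzzy_le chain_find_le ?chain_find_lt //.
  have gs := chain_group (chain_find_lt x).
  by rewrite -[nth _ _ _]/(gval (Group gs)) groupV /=
    -chain_find_le // chain_find_lt.
Qed.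

(** The first layer contains 1; strictness of each inclusion supplies an element of every later
    layer. *)
Lemma chain_find_onto i : (i < size s)%N -> exists x, layer x = i.
Proof.
case: i => [|i] is_.
  exists 1%g; apply/eqP; rewrite -leqn0 chain_find_le //.
  by case/group_setP: (chain_group is_).
case/and3P: sC => _ /(sortedP G) /(_ _ is_) /properP[_ [x xi xNi]] _.
exists x; apply/eqP; rewrite eqn_leq chain_find_le // xi /=.
by rewrite ltnNge chain_find_le // ltnW.
Qed.

(** As no layer is empty, the values are exactly [1 / (i + 1)] for [i < size s], and the level set
    at [1 / (i + 1)] is the [i]-th term. *)
Lemma fuzzy_chain_chain_fuzzy : fuzzy_chain chain_fuzzy = s.
Proof.
rewrite /fuzzy_chain.
rewrite (@fuzzy_values_unique _ [seq i.+1%:R^-1 | i <- iota 0 (size s)]).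
- rewrite -map_comp; apply: (@eq_from_nth _ G).
    by rewrite size_map size_iota.
  move=> i; rewrite size_map size_iota => is_.
  rewrite (nth_map 0%N) ?size_iota // nth_iota // add0n.
  by apply/setP => x; rewrite inE chain_fuzzy_le chain_find_le.
- rewrite sorted_map; apply: sub_sorted (iota_ltn_sorted 0 (size s)) => i j /= ij.
  by rewrite ltf_pV2 ?posrE ?ltr0n // ltr_nat.
- move=> a; apply/mapP/codomP => [[i]|[x ->]].
    rewrite mem_iota add0n => /= is_ ->.
    by have [x <-] := chain_find_onto is_; exists x.
  by exists (layer x); rewrite ?mem_iota ?chain_find_lt.
Qed.

End Realize.

Lemma chain_orders_sorted {s} : subgroup_chain s -> sorted ltn (chain_orders s).
Proof.
case/and3P=> _ ss _; rewrite sorted_map.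
by apply: sub_sorted ss => A B; apply: proper_card.
Qed.

Lemma fuzzy_approx_orders {mu eta} : fuzzy_approx mu eta ->
  chain_orders (fuzzy_chain mu) = chain_orders (fuzzy_chain eta).
Proof.
case=> f _ <-; rewrite /chain_orders -map_comp; apply: eq_map => H /=.
by rewrite card_imset //; apply: perm_inj.
Qed.

End FuzzyChain.

(** * Subgroups of [S_3] and conjugacy of their chains *)

Section S3.
Local Notation gT := {perm 'I_3}.
Local Notation G := ([set: gT]%SET : {set gT}).
Implicit Types (H K : {group gT}) (s t : seq {set gT}).

Lemma card_S3 : #|G| = 6%N.
Proof. by rewrite cardsT card_Sn. Qed.

Lemma card_S3_subgroup H : #|H| \in divisors 6.
Proof. by rewrite -dvdn_divisors // -card_S3 cardSg // finset.subsetT. Qed.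

(** Orders 2 and 3 are the full prime parts of 6, so Sylow's theorem applies; orders 1 and 6 leave
    only one subgroup each. *)
Lemma S3_conj H K : #|H| = #|K| -> exists x, K :=: (H :^ x)%g.
Proof.
move=> eHK.
have sylowHK (p : nat) : #|H| = (p ^ logn p 6)%N -> exists x, K :=: (H :^ x)%g.
  move=> cH.
  have sH : (p.-Sylow(G) H)%g by rewrite pHallE finset.subsetT card_S3 p_part cH /=.
  have sK : (p.-Sylow(G) K)%g by rewrite pHallE finset.subsetT card_S3 p_part -eHK cH /=.
  by have [x _ ->] := Sylow_trans sH sK; exists x.
have := card_S3_subgroup H.
rewrite !inE => /or4P[] /eqP cH.
- exists 1%g; rewrite conjsg1.
  by rewrite (card1_trivg cH) (card1_trivg (etrans (esym eHK) cH)).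
- by apply: (sylowHK 2%N); rewrite cH.
- by apply: (sylowHK 3%N); rewrite cH.
- exists 1%g; rewrite conjsg1.
  have full (L : {group gT}) : #|L| = 6%N -> L :=: G.
    by move=> cL; apply/eqP; rewrite eqEcard finset.subsetT card_S3 cL.
  by rewrite (full H) // full // -eHK.
Qed.

(** The two are conjugate, and [H] is normal: it is trivial, of index 2, or the whole group. *)
Lemma S3_eq_of_card H K : #|H| = #|K| -> #|H| != 2%N -> H :=: K.
Proof.
move=> eHK H2; have [x ->] := S3_conj eHK; apply/esym/normP.
have : G \subset ('N(H))%g; last by move/fintype.subsetP; apply; rewrite inE.
have := card_S3_subgroup H.
rewrite !inE (negPf H2) /= => /or3P[] /eqP cH.
- by rewrite (card1_trivg cH) norm1 fintype.subxx.
- apply/normal_norm/index2_normal; first exact: finset.subsetT.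
  by rewrite -divgS ?finset.subsetT // card_S3 cH.
- have -> : H :=: G.
    by apply/eqP; rewrite eqEcard finset.subsetT card_S3 cH.
  exact: normG.
Qed.

(** Orders strictly increase, so at most one term has order 2. An element conjugating that term
    correctly works for the whole chain, the other terms being determined by their orders. *)
Lemma S3_chain_conj s t : subgroup_chain s -> subgroup_chain t ->
  chain_orders s = chain_orders t ->
  exists x, [seq (H :^ x)%g | H : {set gT} <- t] = s.
Proof.
move=> sC tC est.
have szst : size s = size t by rewrite -(size_map (fun H : {set gT} => #|H|) s)
   -[map _ s]/(chain_orders s) est size_map.
pose Gs i := nth G s i; pose Gt i := nth G t i.
have cst i : (i < size t)%N -> #|Gs i| = #|Gt i|.
  move=> it; have := congr1 (fun c => nth 0%N c i) est.
  by rewrite /chain_orders !(nth_map G) ?szst.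
have gs i (it : (i < size t)%N) : group_set (Gs i).
  by apply: chain_group; rewrite ?szst.
have gt i (it : (i < size t)%N) : group_set (Gt i) by apply: chain_group.
(* If no term has order 2, [i0] equals the length of [t] and any [x] will do. *)
pose i0 := index 2%N (chain_orders t).
have [x xP] : exists x, (i0 < size t)%N -> Gs i0 = (Gt i0 :^ x)%g.
  have [i0t|] := ltnP i0 (size t); last by exists 1%g.
  have [x e] := @S3_conj (Group (gt _ i0t)) (Group (gs _ i0t)) (esym (cst _ i0t)).
  by exists x.
exists x; apply: (@eq_from_nth _ G); first by rewrite size_map.
move=> i; rewrite size_map => it; rewrite (nth_map G) //.
rewrite -/(Gs i) -/(Gt i).
have [c2|c2] := eqVneq #|Gt i| 2%N.
  suff -> : i = i0 by rewrite xP // /i0 -(size_map (fun H : {set gT} => #|H|) t)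
    index_mem; apply/mapP; exists (Gt i); rewrite ?mem_nth.
  have ut : uniq (chain_orders t).
    by apply: sorted_uniq (chain_orders_sorted tC); [apply: ltn_trans | apply: ltnn].
  by rewrite -[LHS](index_uniq 0%N _ ut) ?size_map // (nth_map G) // -/(Gt i) c2.
have := @S3_eq_of_card (Group (gt _ it) :^ x)%G (Group (gs _ it)).
by apply; rewrite /= cardJg // cst.
Qed.

(** Inner automorphisms turn conjugacy of chains into the relation [fuzzy_approx]. *)
Lemma conj_imset_aut (x : gT) :
  exists2 f : {perm gT}, f \in Aut [set: gT]%G
    & forall H : {set gT}, (f @: H)%SET = (H :^ x)%g.
Proof.
exists (conj_aut [set: gT]%G x); first exact: Aut_aut.
move=> H; apply: eq_imset => y; rewrite norm_conj_autE ?inE //.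
by apply/fintype.subsetP => z; rewrite inE.
Qed.

Lemma fuzzy_approx_S3 (R : realType) (mu eta : gT -> R) :
  fuzzy_subgroup mu -> fuzzy_subgroup eta ->
  fuzzy_approx mu eta <->
  chain_orders (fuzzy_chain mu) = chain_orders (fuzzy_chain eta).
Proof.
move=> Fmu Feta; split=> [|e]; first exact: fuzzy_approx_orders.
have [x ex] := S3_chain_conj (fuzzy_chain_subgroup_chain Fmu)
  (fuzzy_chain_subgroup_chain Feta) e.
by have [f fA fE] := conj_imset_aut x; exists f => //; rewrite -ex; apply: eq_map.
Qed.

(** * The possible sequences of orders *)

Definition S3_orders : seq (seq nat) :=
  [:: [:: 6]; [:: 1; 6]; [:: 2; 6]; [:: 3; 6]; [:: 1; 2; 6]; [:: 1; 3; 6]]%N.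

Lemma chain_orders_S3 s : subgroup_chain s -> chain_orders s \in S3_orders.
Proof.
move=> sC; have os := chain_orders_sorted sC.
case/and3P: (sC) => /allP sg ss sT.
have div6 n : n \in chain_orders s -> n \in divisors 6.
  case/mapP=> H /sg gH ->.
  exact: (card_S3_subgroup (Group gH)).
have in6 : 6%N \in chain_orders s by rewrite -card_S3 map_f.
(* Two terms of a chain are comparable, so the one of order 2 would lie in the one of order 3,
   against Lagrange. *)
have not23 : ~~ ((2%N \in chain_orders s) && (3%N \in chain_orders s)).
  apply/negP=> /andP[/mapP[A As cA] /mapP[B Bs cB]].
  have AB : A \subset B.
    have [i is_ eA] := nthP G As; have [j js eB] := nthP G Bs.
    have [ij|/ltnW ji] := leqP i j; rewrite -eA -eB.
      by apply: chain_nth_subset; rewrite ?ij.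
    have := @chain_nth_subset _ _ sC j i; rewrite ji is_ eA eB => /(_ isT) BA.
    by have := subset_leq_card BA; rewrite -cA -cB.
  have := @cardSg _ (Group (sg _ Bs)) (Group (sg _ As)) AB.
  by rewrite /= -cA -cB.
(* A strictly increasing list is determined by its members. *)
have -> : chain_orders s = [seq n <- divisors 6 | n \in chain_orders s].
  apply: (irr_sorted_eq ltn_trans ltnn os).
    by apply: sorted_filter; first exact: ltn_trans.
  move=> n; rewrite mem_filter; case ns: (n \in _) => //=.
  by rewrite div6.
rewrite /= in6; move: not23.
(* Of the eight cases for membership of 1, 2 and 3, [not23] excludes two; the other six are
   listed. *)
by do 3 case: (_ \in chain_orders s).
Qed.

(** Sylow subgroups [P] and [Q] serve as the terms of order 2 and 3. *)
Lemma S3_orders_realized c : c \in S3_orders ->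
  exists2 s : seq {set gT}, subgroup_chain s & chain_orders s = c.
Proof.
have [P sP] := Sylow_exists 2 [set: gT]%G.
have [Q sQ] := Sylow_exists 3 [set: gT]%G.
have cP : #|P| = 2%N by rewrite (card_Hall sP) card_S3 p_part.
have cQ : #|Q| = 3%N by rewrite (card_Hall sQ) card_S3 p_part.
have c1 : #|(1%g : {set gT})| = 1%N by rewrite cards1.
have prop (A B : {set gT}) : A \subset B -> (#|A| < #|B|)%N -> A \proper B.
  by move=> AB cAB; rewrite properEcard AB.
have gT1 : group_set G := groupP [set: gT]%G.
have g1 : group_set (1%g : {set gT}) := groupP 1%G.
have gP : group_set P := groupP P.
have gQ : group_set Q := groupP Q.
have pT (A : {set gT}) : (#|A| < 6)%N -> A \proper G.
  by move=> cA; apply: prop; rewrite ?finset.subsetT ?card_S3.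
rewrite !inE => /or4P[/eqP->|/eqP->|/eqP->|/or3P[]/eqP->].
- by exists [:: G]; rewrite /subgroup_chain /chain_orders /= ?gT1 ?inE ?eqxx ?card_S3.
- exists [:: 1%g; G]; rewrite /subgroup_chain /chain_orders /= ?c1 ?card_S3 //.
  by rewrite g1 gT1 pT ?c1 // !inE eqxx orbT.
- exists [:: P : {set gT}; G]; rewrite /subgroup_chain /chain_orders /= ?cP ?card_S3 //.
  by rewrite gP gT1 pT ?cP // !inE eqxx orbT.
- exists [:: Q : {set gT}; G]; rewrite /subgroup_chain /chain_orders /= ?cQ ?card_S3 //.
  by rewrite gQ gT1 pT ?cQ // !inE eqxx orbT.
- exists [:: 1%g; P : {set gT}; G]; rewrite /subgroup_chain /chain_orders /= ?c1 ?cP ?card_S3 //.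
  by rewrite g1 gP gT1 prop ?sub1G ?c1 ?cP // pT ?cP // !inE eqxx !orbT.
- exists [:: 1%g; Q : {set gT}; G]; rewrite /subgroup_chain /chain_orders /= ?c1 ?cQ ?card_S3 //.
  by rewrite g1 gQ gT1 prop ?sub1G ?c1 ?cQ // pT ?cQ // !inE eqxx !orbT.
Qed.

(** * Counting the classes *)

Lemma fuzzy_classes_S3 (R : realType) : fuzzy_classes R gT #= `I_6.
Proof.
pose cls (mu : gT -> R) := [set eta | FL R gT eta /\ fuzzy_approx mu eta].
(* [m i] represents the [i]-th sequence of orders; from 6 on it is a default without meaning. *)
have /choice[m mP] (i : nat) : exists mu : gT -> R,
    (i < 6)%N -> FL R gT mu /\ chain_orders (fuzzy_chain mu) = nth [::] S3_orders i.
  have [i6|] := ltnP i 6; last by exists (fun=> 0).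
  have /S3_orders_realized[s sC <-] : nth [::] S3_orders i \in S3_orders.
    exact: mem_nth.
  exists (chain_fuzzy R s) => _.
  by rewrite fuzzy_chain_chain_fuzzy //; split=> //; apply: chain_fuzzy_subgroup.
(* The class of [mu] is that of [m i], where [i] is the position of its sequence of orders in
   [S3_orders]. *)
have -> : fuzzy_classes R gT = (cls \o m) @` `I_6.
  apply/seteqP; split=> [_ [mu Fmu <-]|_ [i /mP[Fi _] <-]]; last by exists (m i).
  have cS := chain_orders_S3 (fuzzy_chain_subgroup_chain Fmu).
  have i6 : (index (chain_orders (fuzzy_chain mu)) S3_orders < 6)%N.
    by rewrite -index_mem in cS.
  have [Fi ci] := mP _ i6; rewrite nth_index // in ci.
  exists (index (chain_orders (fuzzy_chain mu)) S3_orders) => //=.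
  apply/seteqP; split=> eta [Feta ae]; split=> //; apply/fuzzy_approx_S3 => //.
    by rewrite -ci; apply: fuzzy_approx_orders.
  by rewrite ci; apply: fuzzy_approx_orders.
(* Equal classes give equal sequences of orders, and [S3_orders] has no repetition. *)
apply: inj_card_eq => i j /set_mem /= i6 /set_mem /= j6 e.
have [Fi ci] := mP _ i6; have [Fj cj] := mP _ j6.
have : cls (m i) (m i) by split=> //; apply/fuzzy_approx_S3.
rewrite e => -[_ /fuzzy_approx_orders]; rewrite ci cj => /eqP.
by rewrite nth_uniq // => /eqP.
Qed.

End S3.

Theorem theorem4p4p1 (R : realType) :
  exists N : nat,
    [/\ fuzzy_classes R {perm 'I_3} #= `I_N,
        N%:R = 6^-1 * (10 + 3 * 6 + 2 * 4) :> rat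
      & N = 6%N].
Proof.
by exists 6%N; split; [exact: fuzzy_classes_S3 | |].
Qed.
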